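(* Let $F$ be a global field and let $M_1,M_2$ be objects of $\mathrm{SMod}_F$. Then for all $E_a,E_b$ in $\mathrm{Ext}(M_2,M_1)$, with Baer sum $E_a+E_b$, $$\mathrm{CTP}_{E_a+E_b}=\mathrm{CTP}_{E_a}+\mathrm{CTP}_{E_b}$$ as pairings $\mathrm{Sel}\,M_2\times\mathrm{Sel}\,M_1^{\vee}\to\mathbb{Q}/\mathbb{Z}$.
   Context: Notation. $G_F=\mathrm{Gal}(F^s/F)$; for each place $v$, $G_v\subseteq G_F$ is the absolute Galois group of $F_v$, $I_v$ its inertia subgroup ($=G_v$ if $v$ archimedean), $H^1_{\mathrm{ur}}(G_v,M)=\ker(H^1(G_v,M)\to H^1(I_v,M))$. $C^i,Z^i$ are continuous inhomogeneous cochains/cocycles, $d$ the usual coboundary, a subscript $v$ denotes restriction to $G_v$, $\mathrm{inv}_v\colon H^2(G_v,(F_v^s)^{\times})\to\mathbb{Q}/\mathbb{Z}$. $M^{\vee}=\mathrm{Hom}(M,(F^s)^{\times})$; $\cup_M$ is the cochain cup product $(f_1\cup f_2)(\sigma_1,\dots,\sigma_{i+j})=\langle f_1(\sigma_1,\dots,\sigma_i),\sigma_1\cdots\sigma_if_2(\sigma_{i+1},\dots,\sigma_{i+j})\rangle$ for the evaluation pairing. $\mathrm{SMod}_F$: objects are pairs $(M,\mathscr{W})$ (often written $M$), $M$ a finite discrete $G_F$-module of order indivisible by $\mathrm{char}\,F$, $\mathscr{W}$ a compact open subgroup of the restricted product $\prod'_vH^1(G_v,M)$ with respect to the $H^1_{\mathrm{ur}}(G_v,M)$;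 morphisms are equivariant homomorphisms $f$ with $f(\mathscr{W})\subseteq\mathscr{W}'$. $\mathrm{Sel}(M,\mathscr{W})$ is the group of classes in $H^1(G_F,M)$ whose localizations lie in $\mathscr{W}$. The dual is $(M^{\vee},\mathscr{W}^{\perp})$ with $\mathscr{W}^{\perp}$ the orthogonal complement under $\sum_v\mathrm{inv}_v(x_v\cup_My_v)$. A sequence $0\to(M_1,\mathscr{W}_1)\xrightarrow{\iota}(M,\mathscr{W})\xrightarrow{\pi}(M_2,\mathscr{W}_2)\to0$ is (short) exact if exact on modules with $\iota^{-1}(\mathscr{W})=\mathscr{W}_1$ and $\pi(\mathscr{W})=\mathscr{W}_2$. $\mathrm{CTP}_E$ for such $E$: for $\phi\in\mathrm{Sel}\,M_2$, $\psi\in\mathrm{Sel}\,M_1^{\vee}$ choose representing cocycles $\overline{\phi},\overline{\psi}$; $f\in C^1(G_F,M)$ with $\pi\circ f=\overline{\phi}$; $\epsilon\in C^2(G_F,(F^s)^{\times})$ with $d\epsilon=\iota^{-1}(df)\cup_{M_1}\overline{\psi}$; and $\overline{\phi}_{v,M}\in Z^1(G_v,M)$ with $\pi(\overline{\phi}_{v,M})=\overline{\phi}_v$ and $(\overline{\phi}_{v,M})_v$ representing a class in $\mathscr{W}$. Then $\mathrm{CTP}_E(\phi,\psi)=\sum_v\mathrm{inv}_v\big(\iota^{-1}(f_v-\overline{\phi}_{v,M})\cup_{M_1}\overline{\psi}_v-\epsilon_v\big)$; this is well defined and bilinear. $\mathrm{Ext}(M_2,M_1)$ is the set of isomorphism classes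 of short exact sequences $0\to M_1\to M\to M_2\to0$ in $\mathrm{SMod}_F$. Given $E_a=[0\to M_1\to M_a\to M_2\to0]$ and $E_b=[0\to M_1\to M_b\to M_2\to0]$, the Baer sum $E_a+E_b$ is obtained by pulling back the direct sum sequence $0\to M_1\oplus M_1\to M_a\oplus M_b\to M_2\oplus M_2\to0$ along the diagonal $\Delta\colon M_2\to M_2\oplus M_2$ and then pushing out the result along the codiagonal (sum) $\nabla\colon M_1\oplus M_1\to M_1$, with pullbacks and pushouts taken in $\mathrm{SMod}_F$ (these are again short exact sequences). *)

(* Defs.v *)
From HB Require Import structures.
From mathcomp Require Import all_boot all_order all_algebra.
From mathcomp Require Import ring_quotient generic_quotient fraction separable.
From mathcomp Require Import finmap all_classical reals topology.

Set Implicit Arguments.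
Unset Strict Implicit.
Unset Printing Implicit Defensive.

Import Order.TTheory GRing.Theory Num.Theory.
Local Open Scope quotient_scope.

Local Open Scope classical_set_scope.
Local Open Scope ring_scope.

Definition finite_extension (K L : fieldType) (i : {rmorphism K -> L}) : Prop :=
  exists (n : nat) (e : 'I_n -> L),
    forall x, exists c : 'I_n -> K, x = \sum_(k < n) i (c k) * e k.

Definition global_field (F : fieldType) : Prop :=
  (exists i : {rmorphism rat -> F}, finite_extension i) \/
  (exists2 p : nat, prime p &
     exists i : {rmorphism {fraction {poly 'F_p}} -> F}, finite_extension i).

Definition separable_closure (K L : fieldType) (i : {rmorphism K -> L}) : Prop :=
  (forall x : L, exists2 p : {poly K}, separable_poly p & root (map_poly i p) x)
  /\ (forall p : {poly L}, separable_poly p -> (1 < size p)%N ->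
        exists x, root p x).

Section GaloisGroup.
Variables (K L : fieldType) (i : {rmorphism K -> L}).

Record gal := Gal {
  gal_fun :> L -> L;
  galP : [/\ zmod_morphism gal_fun, monoid_morphism gal_fun, bijective gal_fun
           & forall x, gal_fun (i x) = i x] }.

Lemma gal_inj (g h : gal) : g =1 h -> g = h.
Proof.
case: g h => [g gP] [h hP] /= /funext gh; move: gP; rewrite gh => gP.
by rewrite (Prop_irrelevance gP hP).
Qed.

HB.instance Definition _ := gen_eqMixin gal.
HB.instance Definition _ := gen_choiceMixin gal.

Lemma gal_one_subproof :
  [/\ zmod_morphism (@id L), monoid_morphism (@id L), bijective (@id L)
    & forall x, id (i x) = i x].
Proof. by split=> //; exists id. Qed.

Lemma gal_mul_subproof (g h : gal) :
  [/\ zmod_morphism (g \o h), monoid_morphism (g \o h), bijective (g \o h)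
    & forall x, (g \o h) (i x) = i x].
Proof.
have [gB [g1 gM] gb gi] := galP g; have [hB [h1 hM] hb hi] := galP h; split.
- by move=> x y /=; rewrite hB gB.
- by split=> [|x y] /=; rewrite ?h1 ?hM.
- exact: bij_comp.
- by move=> x /=; rewrite hi gi.
Qed.

Lemma gal_inv_ex (g : gal) : exists f, cancel g f /\ cancel f g.
Proof. by have [_ _ [f fK gK] _] := galP g; exists f. Qed.

Definition gal_inv_fun (g : gal) : L -> L := sval (cid (gal_inv_ex g)).

Lemma gal_funK (g : gal) : cancel g (gal_inv_fun g).
Proof. by case: (svalP (cid (gal_inv_ex g))). Qed.

Lemma gal_invK (g : gal) : cancel (gal_inv_fun g) g.
Proof. by case: (svalP (cid (gal_inv_ex g))). Qed.

Lemma gal_inv_subproof (g : gal) (f := gal_inv_fun g) :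
  [/\ zmod_morphism f, monoid_morphism f, bijective f
    & forall x, f (i x) = i x].
Proof.
have [gB [g1 gM] gb gi] := galP g.
have gI : injective g by exact: can_inj (gal_funK g).
split.
- by move=> x y; apply: gI; rewrite gB !gal_invK.
- by split=> [|x y]; apply: gI; rewrite ?gM !gal_invK.
- by exists g; [exact: gal_invK|exact: gal_funK].
- by move=> x; apply: gI; rewrite gal_invK gi.
Qed.

Definition gal_one := Gal gal_one_subproof.
Definition gal_mul g h := Gal (gal_mul_subproof g h).
Definition gal_inv g := Gal (gal_inv_subproof g).

Lemma gal_mulA : associative gal_mul.
Proof. by move=> f g h; exact: gal_inj. Qed.
Lemma gal_mul1 : left_id gal_one gal_mul.
Proof. by move=> f; exact: gal_inj. Qed.
Lemma gal_mulr1 : right_id gal_one gal_mul.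
Proof. by move=> f; exact: gal_inj. Qed.
Lemma gal_mulV : left_inverse gal_one gal_inv gal_mul.
Proof. by move=> f; apply: gal_inj => x; exact: gal_funK. Qed.
Lemma gal_mulrV : right_inverse gal_one gal_inv gal_mul.
Proof. by move=> f; apply: gal_inj => x; exact: gal_invK. Qed.

HB.instance Definition _ :=
  isGroup.Build gal gal_mulA gal_mul1 gal_mulr1 gal_mulV gal_mulrV.

Lemma galME (g h : gal) x : (g * h)%g x = g (h x). Proof. by []. Qed.

(* basic neighbourhoods of g: the automorphisms agreeing with g on a finite
   subset of L, i.e. the cosets g Gal(L/K(s)) *)
Definition krull_nbhs (g : gal) : set_system gal :=
  filter_from setT (fun s : seq L => [set h : gal | {in s, h =1 g}]).

HB.instance Definition _ := hasNbhs.Build gal krull_nbhs.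

Lemma krull_filter (g : gal) : ProperFilter (nbhs g).
Proof.
apply: filter_from_proper; last by move=> s _; exists g => x.
apply: filter_from_filter; first by exists [::].
move=> s t _ _; exists (s ++ t) => // h hst; split=> x xs; apply: hst;
by rewrite mem_cat xs ?orbT.
Qed.

Lemma krull_singleton (g : gal) (A : set gal) : nbhs g A -> A g.
Proof. by case=> s _; apply => x. Qed.

Lemma krull_nbhs_nbhs (g : gal) (A : set gal) : nbhs g A -> nbhs g (nbhs^~ A).
Proof.
case=> s _ sA; exists s => // h hg; exists s => // k kh; apply: sA => x xs.
by rewrite kh ?hg.
Qed.

HB.instance Definition _ := Nbhs_isNbhsTopological.Build gal
  krull_filter krull_singleton krull_nbhs_nbhs.

End GaloisGroup.

Record gmod (K L : fieldType) (i : {rmorphism K -> L}) := GMod {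
  gmod_sort :> zmodType;
  act : gal i -> gmod_sort -> gmod_sort;
  act_sub : forall g, zmod_morphism (act g);
  act1 : forall m, act 1%g m = m;
  actM : forall g h m, act (g * h)%g m = act g (act h m);
  act_continuous : forall m g, \forall h \near g, act h m = act g m }.

Record ghom (K L : fieldType) (i : {rmorphism K -> L}) (M N : gmod i) := GHom {
  ghom_fun :> {additive M -> N};
  ghom_act : forall g m, ghom_fun (act g m) = act g (ghom_fun m) }.

(* The multiplicative group of a field, written additively: [x + y] is the
   product and [0] is the unit element. *)
Section MultiplicativeGroup.
Variable L : fieldType.

Record Gm := GmMk { Gm_val :> L; Gm_neq0 : Gm_val != 0 }.

HB.instance Definition _ := [isSub for Gm_val].
HB.instance Definition _ := [Choice of Gm by <:].

Definition Gm_one := GmMk (oner_neq0 L).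
Definition Gm_mul (x y : Gm) := GmMk (mulf_neq0 (Gm_neq0 x) (Gm_neq0 y)).
Lemma Gm_inv_subproof (x : Gm) : (Gm_val x)^-1 != 0.
Proof. by rewrite invr_neq0 // Gm_neq0. Qed.
Definition Gm_inv (x : Gm) := GmMk (Gm_inv_subproof x).

Lemma Gm_mulA : associative Gm_mul.
Proof. by move=> x y z; apply: val_inj; exact: mulrA. Qed.
Lemma Gm_mulC : commutative Gm_mul.
Proof. by move=> x y; apply: val_inj; exact: mulrC. Qed.
Lemma Gm_mul1 : left_id Gm_one Gm_mul.
Proof. by move=> x; apply: val_inj; exact: mul1r. Qed.
Lemma Gm_mulV : left_inverse Gm_one Gm_inv Gm_mul.
Proof. by move=> x; apply: val_inj; exact: mulVf (Gm_neq0 x). Qed.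

HB.instance Definition _ :=
  GRing.isZmodule.Build Gm Gm_mulA Gm_mulC Gm_mul1 Gm_mulV.

Lemma Gm_valB (x y : Gm) : Gm_val (x - y) = Gm_val x / Gm_val y.
Proof. by []. Qed.
End MultiplicativeGroup.

Lemma Gm_map_subproof (K L : fieldType) (f : {rmorphism K -> L}) (x : Gm K) :
  f (Gm_val x) != 0.
Proof. by rewrite fmorph_eq0 Gm_neq0. Qed.

Definition Gm_map (K L : fieldType) (f : {rmorphism K -> L}) (x : Gm K) : Gm L :=
  GmMk (Gm_map_subproof f x).

Section GmModule.
Variables (K L : fieldType) (i : {rmorphism K -> L}).

Lemma gal0 (g : gal i) : g 0 = 0.
Proof. by have [gB _ _ _] := galP g; have := gB 0 0; rewrite !subrr. Qed.

Lemma Gm_act_subproof (g : gal i) (x : Gm L) : g (Gm_val x) != 0.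
Proof.
apply/eqP => gx0; have /eqP := Gm_neq0 x; apply.
by apply: (can_inj (gal_funK g)); rewrite gx0 gal0.
Qed.

Definition Gm_act (g : gal i) (x : Gm L) : Gm L := GmMk (Gm_act_subproof g x).

Lemma Gm_act_sub (g : gal i) : zmod_morphism (Gm_act g).
Proof.
move=> x y; apply: val_inj.
change (g (Gm_val x / Gm_val y) = g (Gm_val x) / g (Gm_val y)).
have [_ [g1 gM] _ _] := galP g; rewrite gM; congr (_ * _).
apply: (mulfI (Gm_act_subproof g y)).
by rewrite -gM !divff ?Gm_neq0 ?Gm_act_subproof.
Qed.

Lemma Gm_act1 (x : Gm L) : Gm_act 1%g x = x.
Proof. exact: val_inj. Qed.

Lemma Gm_actM (g h : gal i) (x : Gm L) :
  Gm_act (g * h)%g x = Gm_act g (Gm_act h x).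
Proof. exact: val_inj. Qed.

Lemma Gm_act_continuous (x : Gm L) (g : gal i) :
  \forall h \near g, Gm_act h x = Gm_act g x.
Proof.
exists [:: Gm_val x] => // h hg; apply: val_inj.
by apply: hg; rewrite inE.
Qed.

Definition Gm_mod : gmod i :=
  GMod Gm_act_sub Gm_act1 Gm_actM Gm_act_continuous.
End GmModule.

Lemma subACA (V : zmodType) (a b c d : V) :
  (a - b) - (c - d) = (a - c) - (b - d).
Proof. by rewrite !opprD !opprK addrACA. Qed.

Section Cohomology.
Variables (K L : fieldType) (i : {rmorphism K -> L}) (M : gmod i).
Notation G := (gal i).

(* continuity for the discrete topology on T *)
Definition cont1 (T : Type) (f : G -> T) : Prop :=
  forall g, \forall h \near g, f h = f g.
Definition cont2 (T : Type) (f : G -> G -> T) : Prop :=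
  forall p : G * G, \forall q \near p, f q.1 q.2 = f p.1 p.2.

Definition d0 (m : M) : G -> M := fun g => act g m - m.
Definition d1 (f : G -> M) : G -> G -> M :=
  fun g h => act g (f h) - f (g * h)%g + f g.
Definition d2 (f : G -> G -> M) : G -> G -> G -> M :=
  fun g h k => act g (f h k) - f (g * h)%g k + f g (h * k)%g - f g h.

Definition Z1 : {pred G -> M} := fun f => `[< cont1 f /\ d1 f = 0 >].
Definition Z2 : {pred G -> G -> M} := fun e => `[< cont2 e /\ d2 e = 0 >].

Lemma act0 (g : G) : act g (0 : M) = 0.
Proof. by have := act_sub g (0 : M) 0; rewrite !subrr. Qed.

Lemma d1B f f' : d1 (f - f') = d1 f - d1 f'.
Proof.
apply/funext => g; apply/funext => h; rewrite /d1 /= !fctE act_sub.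
by rewrite subACA addrACA -opprD.
Qed.

Lemma d2B e e' : d2 (e - e') = d2 e - d2 e'.
Proof.
apply/funext => g; apply/funext => h; apply/funext => k.
rewrite /d2 /= !fctE act_sub.
by rewrite subACA addrACA -opprD subACA.
Qed.

Lemma cont1B (f f' : G -> M) : cont1 f -> cont1 f' -> cont1 (f - f').
Proof.
move=> fc fc' g; near=> h; rewrite !fctE; congr (_ - _).
- by near: h; exact: fc.
- by near: h; exact: fc'.
Unshelve. all: by end_near. Qed.

Lemma cont2B (f f' : G -> G -> M) : cont2 f -> cont2 f' -> cont2 (f - f').
Proof.
move=> fc fc' p; near=> q; rewrite !fctE; congr (_ - _).
- by near: q; exact: fc.
- by near: q; exact: fc'.
Unshelve. all: by end_near. Qed.

Lemma Z1_zmod_closed : zmod_closed Z1.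
Proof.
split.
  apply/asboolP; split; first by move=> g; near=> h.
  by have := d1B 0 0; rewrite !subrr.
move=> f f' /asboolP[fc fd] /asboolP[fc' fd']; apply/asboolP.
by split; [exact: cont1B|rewrite d1B fd fd' subrr].
Unshelve. all: by end_near. Qed.

Lemma Z2_zmod_closed : zmod_closed Z2.
Proof.
split.
  apply/asboolP; split; first by move=> g; near=> h.
  by have := d2B 0 0; rewrite !subrr.
move=> f f' /asboolP[fc fd] /asboolP[fc' fd']; apply/asboolP.
by split; [exact: cont2B|rewrite d2B fd fd' subrr].
Unshelve. all: by end_near. Qed.

HB.instance Definition _ := GRing.isZmodClosed.Build (G -> M) Z1 Z1_zmod_closed.
HB.instance Definition _ :=
  GRing.isZmodClosed.Build (G -> G -> M) Z2 Z2_zmod_closed.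

Record cocycle1 := Cocycle1 {
  cocycle1_val :> G -> M; cocycle1P : cocycle1_val \in Z1 }.
HB.instance Definition _ := [isSub for cocycle1_val].
HB.instance Definition _ := [Choice of cocycle1 by <:].
HB.instance Definition _ := [SubChoice_isSubZmodule of cocycle1 by <:].

Record cocycle2 := Cocycle2 {
  cocycle2_val :> G -> G -> M; cocycle2P : cocycle2_val \in Z2 }.
HB.instance Definition _ := [isSub for cocycle2_val].
HB.instance Definition _ := [Choice of cocycle2 by <:].
HB.instance Definition _ := [SubChoice_isSubZmodule of cocycle2 by <:].

Definition B1 : {pred cocycle1} := fun c => `[< exists m, \val c = d0 m >].
Definition B2 : {pred cocycle2} :=
  fun c => `[< exists2 f, cont1 f & \val c = d1 f >].

Lemma d0B m m' : d0 (m - m') = d0 m - d0 m'.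
Proof.
by apply/funext => g; rewrite /d0 !fctE act_sub subACA.
Qed.

Lemma B1_zmod_closed : zmod_closed B1.
Proof.
split.
  apply/asboolP; exists 0; rewrite GRing.val0.
  by apply/funext => g; rewrite /d0 act0 subrr.
move=> c c' /asboolP[m cm] /asboolP[m' cm']; apply/asboolP; exists (m - m').
by rewrite GRing.valB cm cm' d0B.
Qed.

Lemma B2_zmod_closed : zmod_closed B2.
Proof.
split.
  apply/asboolP; exists 0; first by move=> g; near=> h.
  by rewrite GRing.val0; have := d1B 0 0; rewrite !subrr.
move=> c c' /asboolP[m mc cm] /asboolP[m' mc' cm']; apply/asboolP.
exists (m - m'); first exact: cont1B.
by rewrite GRing.valB cm cm' d1B.
Unshelve. all: by end_near. Qed.

HB.instance Definition _ := GRing.isZmodClosed.Build cocycle1 B1 B1_zmod_closed.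
HB.instance Definition _ := GRing.isZmodClosed.Build cocycle2 B2 B2_zmod_closed.

Definition H1 : zmodType := Quotient.quot B1.
Definition H2 : zmodType := Quotient.quot B2.

(* the class of a cocycle; cochains that are not cocycles are sent to 0 *)
Definition cls1 (f : G -> M) : H1 :=
  \pi_(Quotient.quot B1) (insubd (0 : cocycle1) f).
Definition cls2 (e : G -> G -> M) : H2 :=
  \pi_(Quotient.quot B2) (insubd (0 : cocycle2) e).

Definition rep1 (x : H1) : G -> M := \val (repr (x : Quotient.quot B1)).

Lemma rep1_Z1 x : rep1 x \in Z1.
Proof. exact: cocycle1P. Qed.

Lemma rep1K x : cls1 (rep1 x) = x.
Proof. by rewrite /cls1 /rep1 valKd reprK. Qed.

Lemma cls1B c c' : c \in Z1 -> c' \in Z1 -> cls1 (c - c') = cls1 c - cls1 c'.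
Proof.
move=> cZ cZ'; rewrite /cls1 -[RHS]raddfB; congr (\pi _).
by apply: val_inj; rewrite GRing.valB !insubdK // rpredB.
Qed.

Lemma cls1_eq c c' : c \in Z1 -> c' \in Z1 ->
  cls1 c = cls1 c' <-> exists m, c - c' = d0 m.
Proof.
move=> cZ cZ'; rewrite /cls1; split.
  move=> /eqP; rewrite -Quotient.idealrBE => /asboolP[m].
  by rewrite GRing.valB !insubdK //; exists m.
move=> [m cm]; apply/eqP; rewrite -Quotient.idealrBE; apply/asboolP; exists m.
by rewrite GRing.valB !insubdK.
Qed.

End Cohomology.

Arguments act0 {K L i M} g.
Arguments Z1 {K L i} M _ : rename.
Arguments Z2 {K L i} M _ : rename.
Arguments H1 {K L i} M.
Arguments H2 {K L i} M.

Definition Zrat : {pred rat} := fun q => q \is a Num.int.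
Lemma Zrat_zmod_closed : zmod_closed Zrat.
Proof. by split=> [|x y]; [exact: rpred0|exact: rpredB]. Qed.
HB.instance Definition _ := GRing.isZmodClosed.Build rat Zrat Zrat_zmod_closed.

Definition QmodZ : zmodType := Quotient.quot Zrat.
Definition toQmodZ (q : rat) : QmodZ := \pi_(Quotient.quot Zrat) q.

Section RestrictedProduct.
Variables (I : choiceType) (T : I -> zmodType) (U : forall k, zmodClosed (T k)).

Record rprod := RProd {
  rcoord :> forall k, T k;
  rcoordP : finite_set [set k | rcoord k \notin U k] }.

Lemma rprod_inj (x y : rprod) : (forall k, x k = y k) -> x = y.
Proof.
case: x y => [x xP] [y yP] /= xy.
have {}xy : x = y by exact/functional_extensionality_dep.
by move: xP; rewrite xy => xP; rewrite (Prop_irrelevance xP yP).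
Qed.

HB.instance Definition _ := gen_eqMixin rprod.
HB.instance Definition _ := gen_choiceMixin rprod.

Lemma rprod_zero_subproof : finite_set [set k | (0 : T k) \notin U k].
Proof.
by apply: sub_finite_set (finite_set0 _) => k /=; rewrite rpred0.
Qed.

Lemma rprod_opp_subproof (x : rprod) : finite_set [set k | - x k \notin U k].
Proof.
by apply: sub_finite_set (rcoordP x) => k /=; rewrite rpredN.
Qed.

Lemma rprod_add_subproof (x y : rprod) :
  finite_set [set k | x k + y k \notin U k].
Proof.
apply: (@sub_finite_set _ _
  ([set k | x k \notin U k] `|` [set k | y k \notin U k])).
  move=> k /= xyk; apply: contrapT => /not_orP[/negP/negPn xk /negP/negPn yk].
  by move: xyk; rewrite rpredD.
by rewrite finite_setU; split; exact: rcoordP.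
Qed.

Definition rprod_zero := RProd rprod_zero_subproof.
Definition rprod_opp x := RProd (rprod_opp_subproof x).
Definition rprod_add x y := RProd (rprod_add_subproof x y).

Lemma rprod_addA : associative rprod_add.
Proof. by move=> x y z; apply: rprod_inj => k; exact: addrA. Qed.
Lemma rprod_addC : commutative rprod_add.
Proof. by move=> x y; apply: rprod_inj => k; exact: addrC. Qed.
Lemma rprod_add0 : left_id rprod_zero rprod_add.
Proof. by move=> x; apply: rprod_inj => k; exact: add0r. Qed.
Lemma rprod_addN : left_inverse rprod_zero rprod_opp rprod_add.
Proof. by move=> x; apply: rprod_inj => k; exact: addNr. Qed.

HB.instance Definition _ :=
  GRing.isZmodule.Build rprod rprod_addA rprod_addC rprod_add0 rprod_addN.

(* open boxes prod_k B_k with B_k = U_k for almost all k; every subset of the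
   discrete group T k is open *)
Definition rprod_boxes : set (set rprod) :=
  [set A | exists2 B : forall k, set (T k),
             finite_set [set k | B k <> [set` U k]] &
             A = [set x : rprod | forall k, B k (x k)]].

HB.instance Definition _ := isSubBaseTopological.Build rprod rprod_boxes id.

End RestrictedProduct.

Section RestrictedProductMap.
Variables (I : choiceType) (T T' : I -> zmodType).
Variables (U : forall k, zmodClosed (T k)) (U' : forall k, zmodClosed (T' k)).
Variables (f : forall k, T k -> T' k).
Hypothesis fU : forall k x, x \in U k -> f x \in U' k.

Lemma rprod_map_subproof (x : rprod U) :
  finite_set [set k | f (x k) \notin U' k].
Proof.
apply: sub_finite_set (rcoordP x) => k /=; apply: contra; exact: fU.
Qed.

Definition rprod_map (x : rprod U) : rprod U' := RProd (rprod_map_subproof x).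
End RestrictedProductMap.

Section Functoriality.
Variables (K L : fieldType) (i : {rmorphism K -> L}).
Implicit Types M N : gmod i.

Definition H1_map M N (f : ghom M N) (x : H1 M) : H1 N := cls1 (f \o rep1 x).

Lemma ghom_Z1 M N (f : ghom M N) (c : gal i -> M) :
  c \in Z1 M -> f \o c \in Z1 N.
Proof.
move=> /asboolP[cc cd]; apply/asboolP; split.
  by move=> g /=; near=> h; congr (f _); near: h; exact: cc.
apply/funext => g; apply/funext => h.
have := congr1 (fun u => f (u g h)) cd.
by rewrite /d1 /= raddfD raddfB ghom_act raddf0.
Unshelve. all: by end_near. Qed.

(* kernel of the restriction map to H^1(In, M), for a subgroup In; with In the
   inertia group these are the unramified classes *)
Definition H1_ker M (In : set (gal i)) : {pred H1 M} := fun x =>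
  `[< exists c, [/\ c \in Z1 M, cls1 c = x &
        exists m, forall s, In s -> c s = d0 m s] >].
Arguments H1_ker : clear implicits.

Lemma H1_ker_zmod_closed M In : zmod_closed (H1_ker M In).
Proof.
split.
  apply/asboolP; exists 0; split; first exact: rpred0.
    have := @cls1B _ _ _ M 0 0 (rpred0 _) (rpred0 _).
    by rewrite !subrr.
  by exists 0 => s _; rewrite /d0 act0 subrr.
move=> x y /asboolP[c [cZ <- [m cm]]] /asboolP[c' [cZ' <- [m' cm']]].
apply/asboolP; exists (c - c'); split; first exact: rpredB.
  exact: cls1B.
by exists (m - m') => s sI; rewrite d0B !fctE cm // cm'.
Qed.

HB.instance Definition _ M In :=
  GRing.isZmodClosed.Build (H1 M) (H1_ker M In) (H1_ker_zmod_closed M In).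

Lemma H1_map_ker M N (f : ghom M N) In x :
  x \in H1_ker M In -> H1_map f x \in H1_ker N In.
Proof.
move=> /asboolP[c [cZ cx [m cm]]]; apply/asboolP; exists (f \o c); split.
- exact: ghom_Z1.
- rewrite -cx; apply/cls1_eq; [exact: ghom_Z1|exact/ghom_Z1/rep1_Z1|].
  have /cls1_eq : cls1 c = cls1 (rep1 (cls1 c)) by rewrite rep1K.
  move=> /(_ cZ (rep1_Z1 _))[n cn]; exists (f n); apply/funext => g.
  have := congr1 (fun u => f (u g)) cn.
  by rewrite /d0 !fctE /= !raddfB ghom_act.
- by exists (f m) => s sI; rewrite /= cm // /d0 raddfB ghom_act.
Qed.

End Functoriality.
Arguments H1_ker {K L i} M In.

Section ChangeOfGroup.
Variables (K L K' L' : fieldType).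
Variables (i : {rmorphism K -> L}) (i' : {rmorphism K' -> L'}).
Variables (j : {rmorphism L -> L'}) (r : gal i' -> gal i).
Hypothesis rE : forall s x, j (r s x) = s (j x).

Lemma res1 : r 1%g = 1%g.
Proof. by apply: gal_inj => x; apply: (fmorph_inj j); rewrite rE. Qed.

Lemma resM s t : r (s * t)%g = (r s * r t)%g.
Proof.
apply: gal_inj => x; apply: (fmorph_inj j).
by rewrite rE !galME !rE.
Qed.

Lemma res_continuous : continuous r.
Proof.
move=> s A [e _ eA]; exists [seq j x | x <- e] => // t ts.
apply: eA => x xe; apply: (fmorph_inj j); rewrite !rE.
by apply: ts; exact: map_f.
Qed.

Variable M : gmod i.

Lemma res_act_sub s : zmod_morphism (@act _ _ _ M (r s)).
Proof. exact: act_sub. Qed.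
Lemma res_act1 (m : M) : act (r 1%g) m = m.
Proof. by rewrite res1 act1. Qed.
Lemma res_actM s t (m : M) : act (r (s * t)%g) m = act (r s) (act (r t) m).
Proof. by rewrite resM actM. Qed.
Lemma res_act_continuous (m : M) s : \forall t \near s, act (r t) m = act (r s) m.
Proof. exact: (res_continuous (act_continuous m (r s))). Qed.

Definition res_mod : gmod i' :=
  @GMod _ _ i' M (fun s => act (r s)) res_act_sub res_act1 res_actM
    res_act_continuous.

Definition H1_res (x : H1 M) : H1 res_mod := cls1 (M := res_mod) (rep1 x \o r).

End ChangeOfGroup.

Section ChangeOfGroupHom.
Variables (K L K' L' : fieldType).
Variables (i : {rmorphism K -> L}) (i' : {rmorphism K' -> L'}).
Variables (j : {rmorphism L -> L'}) (r : gal i' -> gal i).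
Hypothesis rE : forall s x, j (r s x) = s (j x).
Variables (M N : gmod i) (f : ghom M N).

Definition res_hom : ghom (res_mod rE M) (res_mod rE N) :=
  @GHom _ _ i' (res_mod rE M) (res_mod rE N) f (fun s m => ghom_act f (r s) m).

End ChangeOfGroupHom.

Section Dual.
Variables (K L : fieldType) (i : {rmorphism K -> L}) (M : gmod i).

Definition hom_pred : {pred M -> Gm L} := fun f => `[< zmod_morphism f >].

Lemma hom_zmod_closed : zmod_closed hom_pred.
Proof.
split; first by apply/asboolP => x y; rewrite subrr.
move=> f g /asboolP fB /asboolP gB; apply/asboolP => x y.
by rewrite !fctE fB gB subACA.
Qed.
HB.instance Definition _ :=
  GRing.isZmodClosed.Build (M -> Gm L) hom_pred hom_zmod_closed.

Record Hom := HomMk { hom_fun :> M -> Gm L; homP : hom_fun \in hom_pred }.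
HB.instance Definition _ := [isSub for hom_fun].
HB.instance Definition _ := [Choice of Hom by <:].
HB.instance Definition _ := [SubChoice_isSubZmodule of Hom by <:].

Lemma hom_act_subproof (g : gal i) (f : Hom) :
  (fun m => Gm_act g (f (act g^-1%g m))) \in hom_pred.
Proof.
have /asboolP fB := homP f.
by apply/asboolP => x y; rewrite act_sub fB Gm_act_sub.
Qed.

Definition hom_act (g : gal i) (f : Hom) : Hom := HomMk (hom_act_subproof g f).

Lemma hom_act_sub g : zmod_morphism (hom_act g).
Proof.
move=> f f'; apply: val_inj; apply/funext => m.
exact: Gm_act_sub.
Qed.
Lemma hom_act1 f : hom_act 1%g f = f.
Proof.
apply: val_inj; apply/funext => m /=.
by rewrite Gm_act1 invg1 act1.
Qed.
Lemma hom_actM g h f : hom_act (g * h)%g f = hom_act g (hom_act h f).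
Proof.
apply: val_inj; apply/funext => m /=.
by rewrite Gm_actM invgM actM.
Qed.

Hypothesis Mfin : finite_set [set: M].

Lemma hom_act_continuous f g : \forall h \near g, hom_act h f = hom_act g f.
Proof.
pose P m := [set h | act h (act g^-1%g m) = m /\
  Gm_act h (f (act g^-1%g m)) = Gm_act g (f (act g^-1%g m))].
have /finite_fsetP[X XE] := Mfin.
have /filterS : nbhs g (\bigcap_(m in [set` X]) P m).
  apply: filter_bigI => m _.
  have mE : act g (act g^-1%g m) = m by rewrite -actM mulgV act1.
  near=> h; split; last by near: h; exact: Gm_act_continuous.
  by rewrite -[RHS]mE; near: h; exact: act_continuous.
apply=> h Xh; apply: val_inj; apply/funext => m /=.
have mX : [set` X] m by rewrite -XE.
have [h1 h2] := Xh m mX.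
have -> : act h^-1%g m = act g^-1%g m.
  by rewrite -[in LHS]h1 -actM mulVg act1.
exact: h2.
Unshelve. all: by end_near. Qed.

Definition dual : gmod i :=
  GMod hom_act_sub hom_act1 hom_actM hom_act_continuous.

End Dual.

Section CupProduct.
Variables (K L : fieldType) (i : {rmorphism K -> L}) (M N : gmod i).
Variables (A : Type) (b : M -> N -> A).

Definition cup11 (f1 : gal i -> M) (f2 : gal i -> N) : gal i -> gal i -> A :=
  fun g h => b (f1 g) (act g (f2 h)).
Definition cup21 (f1 : gal i -> gal i -> M) (f2 : gal i -> N) :
    gal i -> gal i -> gal i -> A :=
  fun g h k => b (f1 g h) (act (g * h)%g (f2 k)).

End CupProduct.

Section AbsoluteValues.
Variables (R : realType) (K : fieldType).

Definition absval (a : K -> R) : Prop :=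
  [/\ forall x, 0 <= a x /\ (a x = 0 <-> x = 0),
      forall x y, a (x * y) = a x * a y,
      forall x y, a (x + y) <= a x + a y
    & exists x, x <> 0 /\ a x <> 1].

Definition nonarchimedean (a : K -> R) : Prop :=
  forall x y, a (x + y) <= Num.max (a x) (a y).

Definition absval_equiv (a b : K -> R) : Prop :=
  forall x, a x < 1 <-> b x < 1.

Record place := Place {
  place_class : set (K -> R);
  placeP : exists2 a, absval a &
    place_class = [set b | absval b /\ absval_equiv a b] }.

HB.instance Definition _ := gen_eqMixin place.
HB.instance Definition _ := gen_choiceMixin place.
End AbsoluteValues.

(* The completion F_v of F at v, a separable closure of F_v with the extension
   of the absolute value, an F-embedding of F^s into it, and the induced map
   from G_v = Gal(F_v^s / F_v) to G_F. *)
Record localization (R : realType) (F Fs : fieldType)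
    (iota : {rmorphism F -> Fs}) (v : place R F) := Localization {
  loc_field : fieldType;
  loc_sep : fieldType;
  loc_in : {rmorphism F -> loc_field};
  loc_iota : {rmorphism loc_field -> loc_sep};
  loc_abs : loc_sep -> R;
  loc_abs_absval : absval loc_abs;
  loc_abs_place : place_class v (fun x => loc_abs (loc_iota (loc_in x)));
  loc_dense : forall (x : loc_field) (e : R), 0 < e ->
    exists y : F, loc_abs (loc_iota (x - loc_in y)) < e;
  loc_complete : forall u : nat -> loc_field,
    (forall e : R, 0 < e -> exists N : nat, forall m n : nat,
       (N <= m)%N -> (N <= n)%N -> loc_abs (loc_iota (u m - u n)) < e) ->
    exists l : loc_field, forall e : R, 0 < e -> exists N : nat,
      forall n : nat, (N <= n)%N -> loc_abs (loc_iota (u n - l)) < e;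
  loc_sepP : separable_closure loc_iota;
  loc_emb : {rmorphism Fs -> loc_sep};
  loc_embE : forall x, loc_emb (iota x) = loc_iota (loc_in x);
  loc_res : gal loc_iota -> gal iota;
  loc_resE : forall s x, loc_emb (loc_res s x) = s (loc_emb x) }.

Arguments loc_in {R F Fs iota v} l : rename.
Arguments loc_iota {R F Fs iota v} l : rename.
Arguments loc_abs {R F Fs iota v} l _ : rename.
Arguments loc_resE {R F Fs iota v} l s x : rename.
Arguments loc_emb {R F Fs iota v} l : rename.
Arguments loc_res {R F Fs iota v} l _ : rename.

Section LocalField.
Variables (R : realType) (F Fs : fieldType) (iota : {rmorphism F -> Fs}).
Variables (v : place R F) (L : localization iota v).
Notation a := (loc_abs L).
Notation Gv := (gal (loc_iota L)).

Definition inertia : set Gv :=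
  [set s | nonarchimedean a -> forall x, a x <= 1 -> a (s x - x) < 1].

Definition uniformizer (p : loc_field L) : Prop :=
  [/\ p <> 0, a (loc_iota L p) < 1
    & forall x, a (loc_iota L x) < 1 -> a (loc_iota L x) <= a (loc_iota L p)].

Definition residue_card (q : nat) : Prop :=
  exists2 s : 'I_q -> loc_field L, (forall k, a (loc_iota L (s k)) <= 1) &
    forall x, a (loc_iota L x) <= 1 ->
      exists! k, a (loc_iota L (x - s k)) < 1.

Definition frobenius (phi : Gv) : Prop :=
  exists2 q, residue_card q & forall x, a x <= 1 -> a (phi x - x ^+ q) < 1.

(* The invariant map. At a nonarchimedean place it is the composite of
   the inverse of the inflation
     H^2(G_v / I_v, Gm(F_v^nr)) -> H^2(G_v, Gm(F_v^s)),
   the normalized valuation to H^2(G_v / I_v, Z), the inverse of the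
   connecting map H^1(G_v / I_v, Q/Z) -> H^2(G_v / I_v, Z), and evaluation at
   the arithmetic Frobenius. Below c is an unramified cocycle, n its valuation
   and chi a rational cochain with coboundary n, so that chi mod Z is a
   character. At an archimedean place, H^2 has order at most 2. *)
Record invariant_map := InvariantMap {
  inv_map :> {additive H2 (Gm_mod (loc_iota L)) -> QmodZ};
  inv_nonarch : nonarchimedean a ->
    forall (p : loc_field L) (phi : Gv) (c : Gv -> Gv -> Gm_mod (loc_iota L))
           (n : Gv -> Gv -> int) (chi : Gv -> rat),
      uniformizer p -> frobenius phi ->
      c \in Z2 (Gm_mod (loc_iota L)) ->
      (forall g h s t, inertia s -> inertia t ->
         c (g * s)%g (h * t)%g = c g h /\ act s (c g h) = c g h) ->
      (forall g h, a (Gm_val (c g h)) = a (loc_iota L p) ^ n g h) ->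
      cont1 chi ->
      (forall g s, inertia s -> chi (g * s)%g = chi g) ->
      (forall g h, chi h - chi (g * h)%g + chi g = (n g h)%:~R) ->
      inv_map (cls2 c) = toQmodZ (chi phi);
  inv_arch : ~ nonarchimedean a -> injective inv_map }.

End LocalField.
Arguments inertia {R F Fs iota v} L _ : rename.

Section SMod.
Variables (R : realType) (F Fs : fieldType) (iota : {rmorphism F -> Fs}).
Variable L : forall v : place R F, localization iota v.
Notation G := (gal iota).
Notation Gv v := (gal (loc_iota (L v))).

Definition at_place (v : place R F) (M : gmod iota) : gmod (loc_iota (L v)) :=
  res_mod (loc_resE (L v)) M.

Definition localize (M : gmod iota) (v : place R F) (x : H1 M) :
    H1 (at_place v M) :=
  H1_res (loc_resE (L v)) x.

Definition H1_ur (M : gmod iota) (v : place R F) : {pred H1 (at_place v M)} :=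
  H1_ker (at_place v M) (inertia (L v)).
Arguments H1_ur : clear implicits.
HB.instance Definition _ M v := GRing.ZmodClosed.on (H1_ur M v).

Definition locprod (M : gmod iota) := rprod (H1_ur M).

Definition locmap (M N : gmod iota) (f : ghom M N) (x : locprod M) : locprod N :=
  rprod_map
    (fun v y => @H1_map_ker _ _ _ _ _ (res_hom (loc_resE (L v)) f) _ y) x.

Record smod := SMod {
  smod_gmod :> gmod iota;
  smod_order : exists2 n : nat, ([set: smod_gmod] #= `I_n)%card &
    forall p, p \in [pchar F] -> ~~ (p %| n)%N;
  smod_cond : set (locprod smod_gmod);
  smod_cond0 : smod_cond 0;
  smod_condB : forall x y, smod_cond x -> smod_cond y -> smod_cond (x - y);
  smod_cond_open : open smod_cond;
  smod_cond_compact : compact smod_cond }.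
Arguments smod_cond : clear implicits.

Lemma smod_finite (M : smod) : finite_set [set: M].
Proof. by have [n Mn _] := smod_order M; exists n. Qed.

Record mor (M N : smod) := Mor {
  mor_ghom :> ghom M N;
  mor_cond : locmap mor_ghom @` smod_cond M `<=` smod_cond N }.

Definition short_exact (M1 M M2 : smod) (i : mor M1 M) (p : mor M M2) : Prop :=
  [/\ injective i, forall y, p y = 0 <-> exists x, i x = y,
      forall z, exists y, p y = z,
      locmap i @^-1` smod_cond M = smod_cond M1
    & locmap p @` smod_cond M = smod_cond M2].

(* representatives of the elements of Ext(M2, M1) *)
Record ext (M2 M1 : smod) := Extension {
  ext_mid :> smod;
  ext_in : mor M1 ext_mid;
  ext_pr : mor ext_mid M2;
  ext_exact : short_exact ext_in ext_pr }.

Definition Sel (M : gmod iota) (W : set (locprod M)) : set (H1 M) :=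
  [set x | exists2 w, W w & forall v, w v = localize v x].

Definition sdual (M : smod) : gmod iota := dual (smod_finite M).

Definition ev (M : smod) (m : M) (f : sdual M) : Gm_mod iota :=
  (f : Hom M) m.
Definition ev_at (v : place R F) (M : smod)
    (m : at_place v M) (f : at_place v (sdual M)) : Gm_mod (loc_iota (L v)) :=
  Gm_map (loc_emb (L v)) ((f : Hom M) m).
Arguments ev_at : clear implicits.

Variable inv : forall v, invariant_map (L v).

Definition sdual_cond (M : smod) : set (locprod (sdual M)) :=
  [set y : locprod (sdual M) | forall x, smod_cond M x ->
     \sum_(v \in [set: place R F])
        inv v (cls2 (cup11 (ev_at v M) (rep1 (x v)) (rep1 (y v)))) = 0].

Section CTP.
Variables (M1 M2 : smod) (E : ext M2 M1).

(* inverse of the injection M1 -> E on its image *)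
Definition ext_inV (y : E) : M1 := xget 0 [set x | ext_in E x = y].

(* The choices entering the definition of the pairing. The term at v is the
   class of a cocycle of G_v with values in the units of F_v^s. *)
Record ctp_choice (phi : H1 M2) (psi : H1 (sdual M1)) := CTPChoice {
  ctp_phi : G -> M2;
  ctp_phiP : ctp_phi \in Z1 M2 /\ cls1 ctp_phi = phi;
  ctp_psi : G -> sdual M1;
  ctp_psiP : ctp_psi \in Z1 (sdual M1) /\ cls1 ctp_psi = psi;
  ctp_f : G -> E;
  ctp_fP : cont1 ctp_f /\ forall g, ext_pr E (ctp_f g) = ctp_phi g;
  ctp_eps : G -> G -> Gm_mod iota;
  ctp_epsP : cont2 ctp_eps /\
    d2 ctp_eps =
      cup21 (@ev M1) (fun g h => ext_inV (d1 ctp_f g h)) ctp_psi;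
  ctp_loc : forall v, Gv v -> at_place v E;
  ctp_locP : forall v, @ctp_loc v \in Z1 (at_place v E) /\
    forall s, ext_pr E (@ctp_loc v s) = ctp_phi (loc_res (L v) s);
  ctp_locW : exists2 w, smod_cond E w & forall v, w v = cls1 (@ctp_loc v) }.
Arguments ctp_loc {phi psi} c v _ : rename.

Definition ctp_term phi psi (c : ctp_choice phi psi) (v : place R F) : QmodZ :=
  let r := loc_res (L v) in
  inv v (cls2 (fun s t : Gv v =>
    cup11 (ev_at v M1) (fun s => ext_inV (ctp_f c (r s) - ctp_loc c v s))
          (fun s => ctp_psi c (r s)) s t
    - Gm_map (loc_emb (L v)) (ctp_eps c (r s) (r t)))).

Definition ctp_sum phi psi (c : ctp_choice phi psi) : QmodZ :=
  \sum_(v \in [set: place R F]) ctp_term c v.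

(* The choices exist, the sum has finitely many nonzero terms (it is 0 by
   convention otherwise), and it does not depend on the choices. *)
Definition CTP_well_defined : Prop :=
  forall phi psi,
    Sel (smod_cond M2) phi -> Sel (@sdual_cond M1) psi ->
    [/\ inhabited (ctp_choice phi psi),
        forall c : ctp_choice phi psi, finite_set [set v | ctp_term c v <> 0]
      & forall c c' : ctp_choice phi psi, ctp_sum c = ctp_sum c'].

(* the common value of the sums *)
Definition CTP phi psi : QmodZ :=
  xget 0 [set x | exists c : ctp_choice phi psi, x = ctp_sum c].

End CTP.

Record biproduct (A B : smod) := Biproduct {
  bi_sum :> smod;
  bi_inl : mor A bi_sum;
  bi_inr : mor B bi_sum;
  bi_prl : mor bi_sum A;
  bi_prr : mor bi_sum B;
  bi_ll : forall x, bi_prl (bi_inl x) = x;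
  bi_lr : forall x, bi_prl (bi_inr x) = 0;
  bi_rl : forall x, bi_prr (bi_inl x) = 0;
  bi_rr : forall x, bi_prr (bi_inr x) = x;
  bi_id : forall x, bi_inl (bi_prl x) + bi_inr (bi_prr x) = x }.

Definition is_pullback (A B C P : smod)
    (f : mor A C) (g : mor B C) (p : mor P A) (q : mor P B) : Prop :=
  (forall x, f (p x) = g (q x)) /\
  forall (T : smod) (s : mor T A) (t : mor T B), (forall x, f (s x) = g (t x)) ->
    exists u : mor T P,
      ((forall x, p (u x) = s x) /\ (forall x, q (u x) = t x)) /\
      forall u' : mor T P,
        (forall x, p (u' x) = s x) -> (forall x, q (u' x) = t x) -> u' =1 u.

Definition is_pushout (C A B Q : smod)
    (f : mor C A) (g : mor C B) (p : mor A Q) (q : mor B Q) : Prop :=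
  (forall x, p (f x) = q (g x)) /\
  forall (T : smod) (s : mor A T) (t : mor B T), (forall x, s (f x) = t (g x)) ->
    exists u : mor Q T,
      ((forall x, u (p x) = s x) /\ (forall x, u (q x) = t x)) /\
      forall u' : mor Q T,
        (forall x, u' (p x) = s x) -> (forall x, u' (q x) = t x) -> u' =1 u.

Definition is_direct_sum (M1 M2 : smod) (Ea Eb : ext M2 M1)
    (S1 : biproduct M1 M1) (S2 : biproduct M2 M2) (S : biproduct Ea Eb)
    (i : mor S1 S) (p : mor S S2) : Prop :=
  [/\ forall x, bi_prl S (i x) = ext_in Ea (bi_prl S1 x),
      forall x, bi_prr S (i x) = ext_in Eb (bi_prr S1 x),
      forall y, bi_prl S2 (p y) = ext_pr Ea (bi_prl S y)
    & forall y, bi_prr S2 (p y) = ext_pr Eb (bi_prr S y)].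

(* E' is the pullback of the sequence 0 -> A -> S -> B -> 0 along f *)
Definition is_pullback_ext (A S B C : smod) (i : mor A S) (p : mor S B)
    (f : mor C B) (E' : ext C A) : Prop :=
  exists u : mor E' S,
    is_pullback p f u (ext_pr E') /\ forall x, u (ext_in E' x) = i x.

(* E' is the pushout of the extension E along f *)
Definition is_pushout_ext (A B C : smod) (E : ext C A) (f : mor A B)
    (E' : ext C B) : Prop :=
  exists u : mor E E',
    is_pushout (ext_in E) f u (ext_in E') /\
    forall y, ext_pr E' (u y) = ext_pr E y.

(* Elements of Ext(M2, M1) are isomorphism classes, and the operations below
   determine E up to isomorphism: the Baer sum is the class of any such E. *)
Definition is_baer_sum (M1 M2 : smod) (Ea Eb E : ext M2 M1) : Prop :=
  exists (S1 : biproduct M1 M1) (S2 : biproduct M2 M2) (S : biproduct Ea Eb)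
         (i : mor S1 S) (p : mor S S2) (diag : mor M2 S2) (codiag : mor S1 M1)
         (P : ext M2 S1),
    [/\ is_direct_sum i p,
        (forall x, bi_prl S2 (diag x) = x /\ bi_prr S2 (diag x) = x),
        (forall x, codiag x = bi_prl S1 x + bi_prr S1 x),
        is_pullback_ext i p diag P
      & is_pushout_ext P codiag E].

End SMod.

Arguments sdual_cond {R F Fs iota L} inv M _.
Arguments smod_cond {R F Fs iota L} s _ : rename.
Arguments CTP_well_defined {R F Fs iota L} inv {M1 M2} E.
Arguments CTP {R F Fs iota L} inv {M1 M2} E phi psi.

(* Main.v *)
(* The pullback P in the definition of the Baer sum maps to Ea, Eb and E over M2,
   its module is the fibre product of those of Ea and Eb over M2, and its local
   conditions W_P map onto those of M2. Choose a class in W_P over the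
   localization of phi; the images of its local cocycles serve as local lifts for
   all three extensions. Changing representatives of phi and psi only changes
   epsilon by a cup product, so the choices for Ea and Eb may be assumed to use
   the same global cocycles. The lifts fa and fb combine to a cochain with values
   in P; pushing it to E and taking epsilon to be the sum of the two epsilons
   gives a choice for E. On the kernel of P -> M2 the map to M1 through E is the
   sum of the maps through Ea and Eb, so the local cocycles add up at every
   place. *)
Require Import Defs.
From mathcomp Require Import all_boot all_order all_algebra.
From mathcomp Require Import all_classical reals topology.
From mathcomp Require Import generic_quotient.
Set Implicit Arguments.
Unset Strict Implicit.
Unset Printing Implicit Defensive.
Import GRing.Theory.
Local Open Scope quotient_scope.
Local Open Scope classical_set_scope.
Local Open Scope ring_scope.

(* [ring] needs a ring; this proves linear identities in a mere zmodType. *)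
Ltac zmod :=
  apply/eqP; rewrite -subr_eq0; apply/eqP;
  rewrite ?(opprD, opprK, oppr0, addr0) -[LHS]addr0 -?addrA;
  repeat match goal with
  | |- - ?x + _ = 0 => rewrite !(addrCA _ x) addNKr
  | |- ?x + _ = 0 => rewrite !(addrCA _ (- x)) addKr
  end; try by [].

(** * Additive maps and sums with finite support *)

Section ZmodMorphisms.
Variables (U V : zmodType) (f : U -> V).
Hypothesis fB : zmod_morphism f.

Lemma zmod_morph0 : f 0 = 0.
Proof. by have := fB 0 0; rewrite !subrr. Qed.

Lemma zmod_morphN : {morph f : x / - x}.
Proof. by move=> x; rewrite -sub0r fB zmod_morph0 sub0r. Qed.

Lemma zmod_morphD : {morph f : x y / x + y}.
Proof. by move=> x y; rewrite -[y in LHS]opprK fB zmod_morphN opprK. Qed.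

End ZmodMorphisms.

(** A sum with infinite support is 0 by convention, so additivity needs both supports to be finite;
    all three sums are then taken over the union of the supports. *)
Lemma fsumrD (I : choiceType) (V : zmodType) (f g : I -> V) :
  finite_set [set k | f k <> 0] -> finite_set [set k | g k <> 0] ->
  \sum_(k \in [set: I]) (f k + g k) =
    \sum_(k \in [set: I]) f k + \sum_(k \in [set: I]) g k.
Proof.
move=> ffin gfin; pose D := [set k | f k <> 0] `|` [set k | g k <> 0].
have Dfin : finite_set D by rewrite finite_setU.
rewrite -!(fsbig_widen D setT) //; first exact: fsbig_split.
- by move=> k [_ /not_orP[_ /contrapT]].
- by move=> k [_ /not_orP[/contrapT]].
- by move=> k [_ /not_orP[/contrapT fk /contrapT gk]] /=; rewrite fk gk addr0.
Qed.

(** * Continuous cochains, coboundaries and cup products *)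

Section Cochains.
Variables (K L : fieldType) (i : {rmorphism K -> L}).
Implicit Types M N T : gmod i.
Local Notation G := (gal i).

Lemma actD M (g : G) : {morph @act _ _ _ M g : x y / x + y}.
Proof. exact/zmod_morphD/act_sub. Qed.

Lemma d1_act M (f : G -> M) g h : f (g * h)%g = act g (f h) + f g - d1 f g h.
Proof. by rewrite /d1; zmod. Qed.

Lemma Z1_mulg M (f : G -> M) g h : f \in Z1 M -> f (g * h)%g = act g (f h) + f g.
Proof.
move=> /asboolP[_ fd]; rewrite d1_act fd.
by rewrite (_ : (0 : G -> G -> M) g h = 0) // subr0.
Qed.

Lemma d1_d0 M (m : M) : d1 (d0 m) = 0.
Proof.
apply/funext => g; apply/funext => h; rewrite /d1 /d0 act_sub actM.
transitivity (0 : M) => [|//]; zmod.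
Qed.

Lemma d2_d1 M (f : G -> M) : d2 (d1 f) = 0.
Proof.
apply/funext => g; apply/funext => h; apply/funext => k.
rewrite /d2 /d1 actD act_sub -!actM !mulgA.
transitivity (0 : M) => [|//]; zmod.
Qed.

Lemma d1_ghom M N (u : ghom M N) (f : G -> M) g h :
  d1 (u \o f) g h = u (d1 f g h).
Proof. by rewrite /d1 raddfD raddfB ghom_act. Qed.

Lemma d0_ghom M N (u : ghom M N) m g : d0 (u m) g = u (d0 m g).
Proof. by rewrite /d0 raddfB ghom_act. Qed.

Lemma d0N M (m : M) g : d0 (- m) g = - d0 m g.
Proof. by rewrite /d0 (zmod_morphN (act_sub g)) opprD. Qed.

Lemma d1D M (f f' : G -> M) : d1 (f + f') = d1 f + d1 f'.
Proof. exact: (zmod_morphD (@d1B _ _ _ M)). Qed.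

Lemma d2D M (e e' : G -> G -> M) : d2 (e + e') = d2 e + d2 e'.
Proof. exact: (zmod_morphD (@d2B _ _ _ M)). Qed.

Lemma d0_Z1 M (m : M) : d0 m \in Z1 M.
Proof.
apply/asboolP; split; last exact: d1_d0.
by move=> g; near=> h; congr (_ - _); near: h; exact: act_continuous.
Unshelve. all: by end_near. Qed.

Lemma cont1D M (f f' : G -> M) : cont1 f -> cont1 f' -> cont1 (f + f').
Proof.
move=> fc f'c g; near=> h; rewrite !fctE; congr (_ + _).
- by near: h; exact: fc.
- by near: h; exact: f'c.
Unshelve. all: by end_near. Qed.

Lemma cont2D M (e e' : G -> G -> M) : cont2 e -> cont2 e' -> cont2 (e + e').
Proof.
move=> ec e'c p; near=> q; rewrite !fctE; congr (_ + _).
- by near: q; exact: ec.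
- by near: q; exact: e'c.
Unshelve. all: by end_near. Qed.

(** Multiplication is continuous for the Krull topology: if [h'] agrees with [h] on [e] and [g']
    agrees with [g] on the image of [e] under [h], then the products agree on [e]. *)
Lemma gal_mul_near (g h : G) (A : set G) : nbhs (g * h)%g A ->
  \forall p \near (g, h), A (p.1 * p.2)%g.
Proof.
case=> e _ eA; exists ([set g' : G | {in map h e, g' =1 g}],
                      [set h' : G | {in e, h' =1 h}]).
  by split; [exists (map h e)|exists e].
move=> [g' h'] [/= g'E h'E]; apply: eA => x xe.
by rewrite !galME h'E // g'E // map_f.
Qed.

Lemma cont1_mul (T : Type) (f : G -> T) :
  cont1 f -> cont2 (fun g h => f (g * h)%g).
Proof. by move=> fc [g h]; exact: gal_mul_near (fc (g * h)%g). Qed.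

Lemma cont1_fst (T : Type) (f : G -> T) : cont1 f -> cont2 (fun g _ => f g).
Proof. by move=> fc [g h]; exact: (@cvg_fst _ _ (nbhs g) (nbhs h) _ _ (fc g)). Qed.

Lemma cont1_snd (T : Type) (f : G -> T) : cont1 f -> cont2 (fun _ h => f h).
Proof. by move=> fc [g h]; exact: (@cvg_snd _ _ (nbhs g) (nbhs h) _ _ (fc h)). Qed.

Lemma cont1_act M (m : M) : cont1 (fun g : G => act g m).
Proof. exact: act_continuous. Qed.

Lemma cont2_act_snd M (c : G -> M) : cont1 c -> cont2 (fun g h : G => act g (c h)).
Proof.
(* The value of [c] is constant near [h], and the action on the fixed element [c h] is constant near
   [g]. *)
move=> cc [g h]; near=> q; transitivity (act q.1 (c h)).
  by congr act; near: q; exact: (cont1_snd cc (g, h)).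
by near: q; exact: (cont1_fst (cont1_act (c h)) (g, h)).
Unshelve. all: by end_near. Qed.

Lemma cont2_d1 M (f : G -> M) : cont1 f -> cont2 (d1 f).
Proof.
move=> fc p; near=> q; rewrite /d1; congr (_ - _ + _).
- by near: q; exact: (cont2_act_snd fc).
- by near: q; exact: (cont1_mul fc).
- by near: q; exact: (cont1_fst fc).
Unshelve. all: by end_near. Qed.

Lemma cls1_d0 M (c : G -> M) m : c \in Z1 M -> cls1 (c + d0 m) = cls1 c.
Proof.
move=> cZ; apply/cls1_eq => //; first by rewrite rpredD ?d0_Z1.
by exists m; rewrite addrAC subrr add0r.
Qed.

Lemma cls2D M (e e' : G -> G -> M) : e \in Z2 M -> e' \in Z2 M ->
  cls2 (e + e') = cls2 e + cls2 e'.
Proof.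
move=> eZ e'Z; rewrite /cls2 -[RHS]raddfD; congr (\pi _).
by apply: val_inj; rewrite GRing.valD !insubdK // rpredD.
Qed.

(** [H1_map] works on a chosen representative; it differs from [c] by a coboundary, and an
    equivariant map carries coboundaries to coboundaries. *)
Lemma H1_map_cls1 M N (u : ghom M N) (c : G -> M) : c \in Z1 M ->
  H1_map u (cls1 c) = cls1 (u \o c).
Proof.
move=> cZ; apply/cls1_eq; [exact/ghom_Z1/rep1_Z1|exact: ghom_Z1|].
have /cls1_eq : cls1 (rep1 (cls1 c)) = cls1 c by rewrite rep1K.
move=> /(_ (rep1_Z1 _) cZ)[m cm]; exists (u m); apply/funext => g.
have := congr1 (fun a => u (a g)) cm.
by rewrite /d0 !fctE /= !raddfB ghom_act.
Qed.

Section Cup.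
Variables (M N T : gmod i) (b : M -> N -> T).
Hypothesis bBl : forall n, zmod_morphism (b^~ n).
Hypothesis bBr : forall m, zmod_morphism (b m).
Hypothesis b_act : forall g m n, act g (b m n) = b (act g m) (act g n).

Let bDl n : {morph (b^~ n) : x y / x + y} := zmod_morphD (bBl n).
Let bDr m : {morph b m : x y / x + y} := zmod_morphD (bBr m).

(** Leibniz rule in degrees 1 and 1; the second term vanishes because [c] is a cocycle. *)
Lemma d2_cup11 (u : G -> M) (c : G -> N) : c \in Z1 N ->
  d2 (cup11 b u c) = cup21 b (d1 u) c.
Proof.
move=> cZ; apply/funext => g; apply/funext => h; apply/funext => k.
rewrite /d2 /cup11 /cup21 b_act (Z1_mulg h k cZ) actD bDr -actM.
by rewrite /d1 bDl bBl; zmod.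
Qed.

(** Leibniz rule for a 2-cocycle and a 0-cochain. It supplies the correction to epsilon when the
    cocycle representing psi changes by [d0 n]. *)
Lemma d2_cup20 (a : G -> G -> M) (n : N) : d2 a = 0 ->
  d2 (fun g h => b (a g h) (act (g * h)%g n)) = cup21 b a (d0 n).
Proof.
move=> ad; apply/funext => g; apply/funext => h; apply/funext => k.
have : d2 a g h k = 0 by rewrite ad.
rewrite /d2 /cup21 /d0 => adE; rewrite act_sub -actM bBr b_act -actM !mulgA.
rewrite -bBl -bDl (_ : _ + _ = a g h) //.
by apply/eqP; rewrite -subr_eq0 adE.
Qed.

Lemma cup21Dl (a a' : G -> G -> M) (c : G -> N) :
  cup21 b (a + a') c = cup21 b a c + cup21 b a' c.
Proof.
apply/funext => g; apply/funext => h; apply/funext => k.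
by rewrite /cup21 !fctE bDl.
Qed.

Lemma cup21Dr (a : G -> G -> M) (c c' : G -> N) :
  cup21 b a (c + c') = cup21 b a c + cup21 b a c'.
Proof.
apply/funext => g; apply/funext => h; apply/funext => k.
by rewrite /cup21 !fctE actD bDr.
Qed.

Lemma cont2_cup11 (u : G -> M) (c : G -> N) :
  cont1 u -> cont1 c -> cont2 (cup11 b u c).
Proof.
move=> uc cc p; near=> q; rewrite /cup11; congr (b _ _).
- by near: q; exact: (cont1_fst uc).
- by near: q; exact: (cont2_act_snd cc).
Unshelve. all: by end_near. Qed.

End Cup.
End Cochains.

(** * Evaluation pairings and restriction to the local Galois groups *)

Section Localization.
Variables (R : realType) (F Fs : fieldType) (iota : {rmorphism F -> Fs}).
Variable L : forall v : place R F, localization iota v.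
Notation G := (gal iota).
Notation Gv v := (gal (loc_iota (L v))).

Lemma Gm_map_sub (K K' : fieldType) (j : {rmorphism K -> K'}) :
  zmod_morphism (Gm_map j).
Proof. by move=> x y; apply: val_inj; rewrite /= rmorphM fmorphV. Qed.

Section Evaluation.
Variables (M : smod L) (v : place R F).
Local Notation ev_v := (@ev_at _ _ _ _ L v M).

Lemma evBl (f : sdual M) : zmod_morphism (@ev _ _ _ _ _ M ^~ f).
Proof. by have /asboolP := homP f. Qed.

Lemma evBr (m : M) : zmod_morphism (@ev _ _ _ _ _ M m).
Proof. by []. Qed.

Lemma ev_act g (m : M) (f : sdual M) : act g (ev m f) = ev (act g m) (act g f).
Proof. by apply: val_inj; rewrite /= -actM mulVg act1. Qed.

Lemma Gm_map_act (s : Gv v) (x : Gm_mod iota) :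
  Gm_map (loc_emb (L v)) (act (loc_res (L v) s) x) =
  act s (Gm_map (loc_emb (L v)) x : Gm_mod (loc_iota (L v))).
Proof. by apply: val_inj; rewrite /= (loc_resE (L v)). Qed.

Lemma ev_atBl (f : at_place L v (sdual M)) : zmod_morphism (ev_v ^~ f).
Proof. by move=> x y; rewrite /ev_at -Gm_map_sub; congr Gm_map; exact: evBl. Qed.

Lemma ev_atBr (m : at_place L v M) : zmod_morphism (ev_v m).
Proof. by move=> x y; rewrite /ev_at -Gm_map_sub. Qed.

Lemma ev_at_act (s : Gv v) (m : at_place L v M) (f : at_place L v (sdual M)) :
  act s (ev_v m f) = ev_v (act s m) (act s f).
Proof.
by rewrite /ev_at -Gm_map_act ev_act. Qed.
End Evaluation.

Section Restriction.
Variables (M : gmod iota) (v : place R F).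
Local Notation r := (loc_res (L v)).

Lemma res_cont1 (T : Type) (f : G -> T) : cont1 f -> cont1 (f \o r).
Proof.
move=> fc s.
exact: (@res_continuous _ _ _ _ _ _ _ _ (loc_resE (L v)) s _ (fc (r s))).
Qed.

Lemma res_cont2 (T : Type) (e : G -> G -> T) :
  cont2 e -> cont2 (fun s t => e (r s) (r t)).
Proof.
move=> ec [s t].
have rc := @res_continuous _ _ _ _ _ _ _ _ (loc_resE (L v)).
have [[A B] [/= rA rB] AB] := ec (r s, r t).
exists (r @^-1` A, r @^-1` B) => [|[s' t'] [/= sA tB]].
  by split; [exact: rc rA|exact: rc rB].
exact: (AB (r s', r t')).
Qed.

Lemma res_d1 (f : G -> M) (s t : Gv v) :
  d1 (f \o r : Gv v -> at_place L v M) s t = d1 f (r s) (r t).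
Proof. by rewrite /d1 /= (resM (loc_resE (L v))). Qed.

Lemma res_Z1 (c : G -> M) : c \in Z1 M -> c \o r \in Z1 (at_place L v M).
Proof.
move=> /asboolP[cc cd]; apply/asboolP; split; first exact: res_cont1.
by apply/funext => s; apply/funext => t; rewrite res_d1 cd.
Qed.
End Restriction.

(** * Choices and local cocycles for a single extension *)

Section Extension.
Variables (M1 M2 : smod L) (E : ext M2 M1).

Lemma ext_inVK : cancel (ext_in E) (@ext_inV _ _ _ _ _ _ _ E).
Proof.
move=> x; have [inI _ _ _ _] := ext_exact E.
by apply: inI; exact: (@xgetI _ _ [set x0 | ext_in E x0 = ext_in E x] x).
Qed.

Lemma ext_inK y : ext_pr E y = 0 -> ext_in E (ext_inV y) = y.
Proof.
have [_ kerE _ _ _] := ext_exact E.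
by move=> /kerE[x <-]; rewrite ext_inVK.
Qed.

Lemma ext_pr_d1 (f : G -> E) g h :
  ext_pr E \o f \in Z1 M2 -> ext_pr E (d1 f g h) = 0.
Proof. by move=> /asboolP[_ fd]; rewrite -d1_ghom fd. Qed.

(** After applying the injective equivariant map [ext_in E], the claim becomes the vanishing of
    [d2 (d1 f)]: the values of [d1 f] die in [M2], so [ext_inV] really inverts there. *)
Lemma d2_ext_inV (f : G -> E) : ext_pr E \o f \in Z1 M2 ->
  d2 (fun g h => ext_inV (d1 f g h)) = 0.
Proof.
move=> fZ; apply/funext => g; apply/funext => h; apply/funext => k.
apply: (can_inj ext_inVK).
rewrite /d2 raddfB raddfD raddfB ghom_act !ext_inK; try exact: ext_pr_d1.
transitivity (d2 (d1 f) g h k) => //.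
by rewrite d2_d1 raddf0.
Qed.

Variables (phi : H1 M2) (psi : H1 (sdual M1)).

(** Lets several extensions share their global cocycles and use prescribed local lifts. If phi
    changes by [d0 m], adding [d0 y] to [f] for a lift [y] of [m] leaves [d1 f] unchanged; if psi
    changes by [d0 n], epsilon gains the cup product of [ext_inV (d1 f)] with [n]. *)
Lemma ctp_choice_change (c : ctp_choice E phi psi)
    (phi' : G -> M2) (psi' : G -> sdual M1) (l : forall v, Gv v -> at_place L v E) :
  phi' \in Z1 M2 -> cls1 phi' = phi ->
  psi' \in Z1 (sdual M1) -> cls1 psi' = psi ->
  (forall v, l v \in Z1 (at_place L v E) /\
     forall s, ext_pr E (l v s) = phi' (loc_res (L v) s)) ->
  (exists2 w, smod_cond E w & forall v, w v = cls1 (l v)) ->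
  exists c' : ctp_choice E phi psi,
    [/\ ctp_phi c' = phi', ctp_psi c' = psi' & @ctp_loc _ _ _ _ _ _ _ _ _ _ c' = l].
Proof.
move=> phi'Z phi'E psi'Z psi'E lP lW.
have [phiZ phiE] := ctp_phiP c; have [psiZ psiE] := ctp_psiP c.
have [fc fE] := ctp_fP c; have [epsc epsd] := ctp_epsP c.
have [m mE] : exists m, phi' - ctp_phi c = d0 m.
  by apply/cls1_eq => //; rewrite phi'E.
have [n nE] : exists n, psi' - ctp_psi c = d0 n.
  by apply/cls1_eq => //; rewrite psi'E.
have [y yE] : exists y, ext_pr E y = m by have [_ _ + _ _] := ext_exact E; apply.
have fZ : ext_pr E \o ctp_f c \in Z1 M2.
  by rewrite (_ : _ \o _ = ctp_phi c) //; apply/funext => g; exact: fE.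
pose a g h := ext_inV (d1 (ctp_f c) g h).
have f'P : cont1 (ctp_f c + d0 y) /\
    forall g, ext_pr E ((ctp_f c + d0 y) g) = phi' g.
  split; first by apply: cont1D => //; have /asboolP[] := d0_Z1 y.
  move=> g; rewrite fctE raddfD fE /d0 raddfB ghom_act yE.
  by have -> : phi' = ctp_phi c + d0 m by rewrite -mE addrC subrK.
have ac : cont2 a.
  by move=> p; near=> q; rewrite /a; congr ext_inV; near: q; exact: cont2_d1.
have eps'P : cont2 (ctp_eps c + (fun g h => ev (a g h) (act (g * h)%g n))) /\
    d2 (ctp_eps c + (fun g h => ev (a g h) (act (g * h)%g n) : Gm_mod iota)) =
      cup21 (@ev _ _ _ _ _ M1) (fun g h => ext_inV (d1 (ctp_f c + d0 y) g h)) psi'.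
  split.
    apply: cont2D => // p; near=> q; congr (ev _ _).
    - by near: q; exact: ac.
    - by near: q; exact: (cont1_mul (cont1_act n)).
  rewrite d2D epsd d1D d1_d0 addr0.
  rewrite (d2_cup20 (@evBl M1) (@evBr M1) (@ev_act M1)); last exact: d2_ext_inV.
  by rewrite -nE -(cup21Dr (@evBr M1)) addrC subrK.
by exists (CTPChoice (conj phi'Z phi'E) (conj psi'Z psi'E) f'P eps'P lP lW).
Unshelve. all: by end_near. Qed.


(** The cochain inside [ctp_term], written as a difference of functions so that [d2B] and [cont2B]
    apply. *)
Definition ctp_cochain (c : ctp_choice E phi psi) (v : place R F) :
    Gv v -> Gv v -> Gm_mod (loc_iota (L v)) :=
  let r := loc_res (L v) in
  cup11 (@ev_at _ _ _ _ L v M1) (fun s => ext_inV (ctp_f c (r s) - ctp_loc c s))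
    (ctp_psi c \o r)
  - (fun s t => Gm_map (loc_emb (L v)) (ctp_eps c (r s) (r t))).
Arguments ctp_cochain : clear implicits.

Lemma ctp_termE inv (c : ctp_choice E phi psi) v :
  ctp_term inv c v = inv v (cls2 (ctp_cochain c v)).
Proof. by []. Qed.

(** Since [cls2] sends non-cocycles to 0, its additivity is available only for cocycles. The local
    lift is itself a cocycle, so subtracting it does not change the coboundary of [f]; the Leibniz
    rule then gives exactly the restriction of [d2] of epsilon. *)
Lemma ctp_cochain_Z2 (c : ctp_choice E phi psi) v :
  ctp_cochain c v \in Z2 (Gm_mod (loc_iota (L v))).
Proof.
have [fc fE] := ctp_fP c; have [epsc epsd] := ctp_epsP c.
have [psiZ _] := ctp_psiP c; have [/asboolP[lc ld] lE] := ctp_locP c v.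
have /asboolP[psic _] := psiZ.
have phiE : ext_pr E \o ctp_f c = ctp_phi c by apply/funext => g; exact: fE.
have fZ : ext_pr E \o ctp_f c \in Z1 M2 by rewrite phiE; case: (ctp_phiP c).
pose r := loc_res (L v).
pose y : Gv v -> at_place L v E := (ctp_f c \o r) - @ctp_loc _ _ _ _ _ _ _ _ _ _ c v.
pose u s : at_place L v M1 := ext_inV (y s).
have yc : cont1 y by apply: cont1B => //; exact: res_cont1.
(* Both terms of [y] project to the restriction of phi, so [y] takes values in the image of [M1]. *)
have uK : res_hom (loc_resE (L v)) (ext_in E) \o u = y.
  by apply/funext => s; apply: ext_inK; rewrite raddfB /= fE lE subrr.
have ud s t : d1 u s t = ext_inV (d1 (ctp_f c) (r s) (r t)).
  apply: (can_inj ext_inVK); rewrite ext_inK ?ext_pr_d1 //.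
  rewrite -[LHS](d1_ghom (res_hom (loc_resE (L v)) (ext_in E))) uK.
  by rewrite d1B ld subr0 res_d1.
apply/asboolP; split.
  apply: cont2B; last first.
    by move=> p; near=> q; congr Gm_map; near: q; exact: (res_cont2 epsc).
  apply: cont2_cup11; last exact: res_cont1.
  by move=> s; near=> t; congr ext_inV; near: t; exact: yc.
rewrite d2B (d2_cup11 (@ev_atBl M1 v) (@ev_atBr M1 v) (@ev_at_act M1 v));
  last exact: res_Z1.
apply/eqP; rewrite subr_eq0; apply/eqP.
apply/funext => s; apply/funext => t; apply/funext => k.
(* [Gm_map] is additive and equivariant, so the local coboundary is the image of the global
   [d2 (ctp_eps c)]. *)
rewrite /d2 -!Gm_map_act !(resM (loc_resE (L v))) -Gm_map_sub.
rewrite -(zmod_morphD (Gm_map_sub _)) -Gm_map_sub.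
rewrite -[X in Gm_map _ X]/(d2 (ctp_eps c) (r s) (r t) (r k)) epsd.
by rewrite /cup21 -/u ud /= (resM (loc_resE (L v))).
Unshelve. all: by end_near. Qed.

End Extension.
Arguments ctp_cochain {M1 M2 E phi psi} c v _ _.

(** * Morphisms out of the pullback in the Baer sum *)

Section Composition.
Variables (M N P : smod L) (f : mor M N) (g : mor N P).

Lemma ghom_comp_act h x : (g \o f) (act h x) = act h ((g \o f) x).
Proof. by rewrite /= !ghom_act. Qed.

Definition ghom_comp : ghom M P := GHom ghom_comp_act.

Lemma ghom_comp_cond : locmap (L := L) ghom_comp @` smod_cond M `<=` smod_cond P.
Proof.
move=> _ [x Mx <-]; apply: (mor_cond (m := g)); exists (locmap f x).
  by apply: (mor_cond (m := f)); exists x.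
by apply: rprod_inj => v; apply: H1_map_cls1; exact/ghom_Z1/rep1_Z1.
Qed.

Definition mor_comp : mor M P := Mor ghom_comp_cond.
End Composition.

(* The module P is the fibre product of Ea and Eb over M2. *)
Lemma baer_sum_span (M1 M2 : smod L) (Ea Eb E : ext M2 M1) :
  is_baer_sum Ea Eb E ->
  exists (P : smod L) (q : mor P M2) (ua : mor P Ea) (ub : mor P Eb) (u : mor P E),
    [/\ locmap q @` smod_cond P = smod_cond M2,
        forall y, [/\ ext_pr Ea (ua y) = q y, ext_pr Eb (ub y) = q y
                    & ext_pr E (u y) = q y],
        forall ya yb, ext_pr Ea ya = ext_pr Eb yb ->
          exists y, ua y = ya /\ ub y = yb
      & forall y xa xb, ua y = ext_in Ea xa -> ub y = ext_in Eb xb ->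
          u y = ext_in E (xa + xb)].
Proof.
move=> [S1 [S2 [S [i [p [diag [codiag [P [[il ir pl pr] diagE codiagE]]]]]]]]].
move=> [w [[wE _] wi]] [u [[uE _] upr]].
have [_ kerP prP _ qW] := ext_exact P.
have [inaI kera pra _ _] := ext_exact Ea; have [inbI kerb prb _ _] := ext_exact Eb.
exists P, (ext_pr P), (mor_comp w (bi_prl S)), (mor_comp w (bi_prr S)), u.
(* The pullback square over the diagonal forces both components of [w y] to have the same image in
   [M2]. *)
have qE y : ext_pr Ea (bi_prl S (w y)) = ext_pr P y /\
            ext_pr Eb (bi_prr S (w y)) = ext_pr P y.
  by rewrite -pl -pr wE; exact: diagE.
split=> //.
- by move=> y; have [? ?] := qE y; split.
(* Any [y0] over the common image is off by an element of [M1] in each component; the pair of these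
   errors is an element of [S1], added through [ext_in P]. *)
- move=> ya yb yab; have [y0 y0E] := prP (ext_pr Ea ya); have [qa qb] := qE y0.
  have /kera[xa xaE] : ext_pr Ea (ya - bi_prl S (w y0)) = 0.
    by rewrite raddfB qa y0E subrr.
  have /kerb[xb xbE] : ext_pr Eb (yb - bi_prr S (w y0)) = 0.
    by rewrite raddfB qb y0E yab subrr.
  have [x [xl xr]] : exists x, bi_prl S1 x = xa /\ bi_prr S1 x = xb.
    exists (bi_inl S1 xa + bi_inr S1 xb); split.
      by rewrite raddfD bi_ll bi_lr addr0.
    by rewrite raddfD bi_rl bi_rr add0r.
  exists (y0 + ext_in P x); split.
    transitivity (bi_prl S (w (y0 + ext_in P x))) => //.
    by rewrite !raddfD wi il xl xaE addrC subrK.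
  transitivity (bi_prr S (w (y0 + ext_in P x))) => //.
  by rewrite !raddfD wi ir xr xbE addrC subrK.
(* Here [y] comes from some [x] in [S1] with components [xa] and [xb], and the pushout square sends
   it to [codiag x]. *)
- move=> y xa xb /= ya yb.
  have /kerP[x xE] : ext_pr P y = 0.
    by have [<- _] := qE y; rewrite ya; apply/kera; exists xa.
  rewrite -xE uE codiagE; congr (ext_in E (_ + _)).
    by apply: inaI; rewrite -ya -xE wi il.
  by apply: inbI; rewrite -yb -xE wi ir.
Qed.

(** * Evaluating the pairing and lifting local cocycles *)

Lemma CTP_ctp_sum inv (M1 M2 : smod L) (E : ext M2 M1) phi psi
    (c : ctp_choice E phi psi) :
  CTP_well_defined inv E -> Sel (smod_cond M2) phi -> Sel (sdual_cond inv M1) psi ->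
  CTP inv E phi psi = ctp_sum inv c.
Proof.
move=> wd phiS psiS; have [_ _ sumE] := wd _ _ phiS psiS.
rewrite /CTP; case: xgetP => [x -> [c' ->]|/(_ (ctp_sum inv c))[]]; first exact: sumE.
by exists c.
Qed.

(** A representative of [z v] maps to [c] only up to some [d0 m]; adding the coboundary of a lift of
    [- m] makes the equality exact without changing the class. *)
Lemma locmap_cocycle_lift (P M : smod L) (q : mor P M) (c : G -> M) (z : locprod L P) :
  (forall m, exists y, q y = m) -> c \in Z1 M ->
  (forall v, locmap q z v = localize L v (cls1 c)) ->
  exists l : forall v, Gv v -> at_place L v P,
    forall v, [/\ l v \in Z1 (at_place L v P), cls1 (l v) = z v
              & forall s, q (l v s) = c (loc_res (L v) s)].
Proof.
move=> q_surj cZ zE.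
suff lift v : exists l : Gv v -> at_place L v P,
    [/\ l \in Z1 (at_place L v P), cls1 l = z v
      & forall s, q (l s) = c (loc_res (L v) s)].
  exists (fun v => projT1 (cid (lift v))) => v; exact: projT2 (cid (lift v)).
pose qv := res_hom (loc_resE (L v)) q.
have zZ := rep1_Z1 (z v).
have : cls1 (qv \o rep1 (z v)) = cls1 (c \o loc_res (L v) : _ -> at_place L v M).
  (* [localize] restricts the chosen representative of the class of [c], not [c] itself; the two
     differ by a global coboundary, which restricts to a local one. *)
  rewrite -[LHS]/(locmap q z v) zE /localize /H1_res.
  apply/cls1_eq; [exact/res_Z1/rep1_Z1|exact: res_Z1|].
  have /cls1_eq : cls1 (rep1 (cls1 c)) = cls1 c by rewrite rep1K.
  move=> /(_ (rep1_Z1 _) cZ)[m cm]; exists m; apply/funext => s.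
  have := congr1 (fun f : G -> M => f (loc_res (L v) s)) cm; exact.
move=> /cls1_eq; case; [exact: ghom_Z1|exact: res_Z1|move=> m mE].
have [y yE] := q_surj (- m).
exists (rep1 (z v) + d0 (y : at_place L v P)); split.
- by rewrite rpredD ?d0_Z1.
- by rewrite cls1_d0 // rep1K.
move=> s; rewrite fctE raddfD -[X in _ + X = _](d0_ghom qv) yE.
have := congr1 (fun f : Gv v -> at_place L v M => f s) mE.
by rewrite d0N => mEs; rewrite -[d0 m s]mEs opprB addrC subrK.
Qed.

End Localization.

Arguments ctp_cochain {R F Fs iota L M1 M2 E phi psi} c v _ _.

(** * Additivity of the pairing under Baer sum *)

Theorem proposition4p4
  (R : realType) (F Fs : fieldType) (iota : {rmorphism F -> Fs})
  (hF : global_field F) (hFs : separable_closure iota)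
  (L : forall v : place R F, localization iota v)
  (inv : forall v : place R F, invariant_map (L v))
  (M1 M2 : smod L) (Ea Eb E : ext M2 M1) (hE : is_baer_sum Ea Eb E)
  (hCTPa : CTP_well_defined inv Ea)
  (hCTPb : CTP_well_defined inv Eb)
  (hCTP : CTP_well_defined inv E)
  (phi : H1 M2) (psi : H1 (sdual M1)) :
  Sel (smod_cond M2) phi -> Sel (sdual_cond inv M1) psi ->
  CTP inv E phi psi = CTP inv Ea phi psi + CTP inv Eb phi psi.
Proof.
move=> phiS psiS; have [w0 w0W w0E] := phiS.
have [P [q [ua [ub [u [qW uq span uin]]]]]] := baer_sum_span hE.
(* One class in W_P provides the local lifts for Ea, Eb and E simultaneously. *)
have [z zW zE] : exists2 z, smod_cond P z & locmap q z = w0.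
  by move: w0W; rewrite -qW => -[z]; exists z.
have q_surj m : exists y, q y = m.
  have [_ _ pra _ _] := ext_exact Ea; have [_ _ prb _ _] := ext_exact Eb.
  have [ya yaE] := pra m; have [yb ybE] := prb m.
  have [|y [uay _]] := span ya yb; first by rewrite yaE.
  by exists y; have [<- _ _] := uq y; rewrite uay.
have [|l lP] := locmap_cocycle_lift q_surj (rep1_Z1 phi) (z := z).
  by move=> v; rewrite rep1K -w0E zE.
have locP (E' : ext M2 M1) (f : mor P E') : (forall y, ext_pr E' (f y) = q y) ->
    (forall v, (f \o l v) \in Z1 (at_place L v E') /\
       forall s, ext_pr E' (f (l v s)) = rep1 phi (loc_res (L v) s)) /\
    (exists2 w, smod_cond E' w & forall v, w v = cls1 (f \o l v : _ -> at_place L v E')).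
  move=> fq; split.
    move=> v; have [lZ _ lq] := lP v; split; last by move=> s; rewrite fq lq.
    exact: (ghom_Z1 (res_hom (loc_resE (L v)) f)).
  exists (locmap f z); first by apply: (mor_cond (m := f)); exists z.
  move=> v; have [lZ lz _] := lP v.
  by rewrite -[LHS]/(H1_map (res_hom (loc_resE (L v)) f) (z v)) -lz H1_map_cls1.
have choice (E' : ext M2 M1) (f : mor P E') : (forall y, ext_pr E' (f y) = q y) ->
    CTP_well_defined inv E' -> exists c : ctp_choice E' phi psi,
    [/\ ctp_phi c = rep1 phi, ctp_psi c = rep1 psi & forall v s, ctp_loc c s = f (l v s)].
  move=> fq wd; have [[c] _ _] := wd _ _ phiS psiS; have [fl fw] := locP _ _ fq.
  have [c' [? ? c'l]] := ctp_choice_change c (rep1_Z1 phi) (rep1K phi)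
    (rep1_Z1 psi) (rep1K psi) fl fw.
  by exists c'; split=> // v s; rewrite c'l.
have uqa y : ext_pr Ea (ua y) = q y by have [] := uq y.
have uqb y : ext_pr Eb (ub y) = q y by have [] := uq y.
have uqE y : ext_pr E (u y) = q y by have [] := uq y.
have [ca [phia psia la]] := choice _ _ uqa hCTPa.
have [cb [phib psib lb]] := choice _ _ uqb hCTPb.
(* Tested after the injection [ext_in E], this is the codiagonal formula [uin]. *)
have inVD y : q y = 0 -> ext_inV (u y) = ext_inV (ua y) + ext_inV (ub y).
  move=> qy; apply: (can_inj (@ext_inVK _ _ _ _ _ _ _ E)).
  rewrite ext_inK ?uqE //; apply: uin; rewrite ext_inK //; first by rewrite uqa.
  by rewrite uqb.
(* The lift depends only on the two values, not on the group element, so [fP] inherits continuity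
   from [ctp_f ca] and [ctp_f cb]. The default 0 never occurs there, since both cochains lie over
   the same cocycle [rep1 phi]. *)
pose lift ya yb : P := xget 0 [set y | ua y = ya /\ ub y = yb].
have liftP ya yb : ext_pr Ea ya = ext_pr Eb yb ->
    ua (lift ya yb) = ya /\ ub (lift ya yb) = yb.
  by move=> /span[y yP]; exact: (@xgetI _ _ [set y | ua y = ya /\ ub y = yb] y).
pose fP g := lift (ctp_f ca g) (ctp_f cb g).
have [fac faE] := ctp_fP ca; have [fbc fbE] := ctp_fP cb.
have fPE g : ua (fP g) = ctp_f ca g /\ ub (fP g) = ctp_f cb g.
  by apply: liftP; rewrite faE fbE phia phib.
have ufa : ua \o fP = ctp_f ca by apply/funext => g; have [] := fPE g.
have ufb : ub \o fP = ctp_f cb by apply/funext => g; have [] := fPE g.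
have qfP g : q (fP g) = rep1 phi g.
  by rewrite -uqa; have [-> _] := fPE g; rewrite faE phia.
have fPc : cont1 fP.
  move=> g; near=> h; congr lift; near: h; [exact: fac|exact: fbc].
have fc : cont1 (u \o fP) /\ forall g, ext_pr E ((u \o fP) g) = rep1 phi g.
  by split=> [g|g]; [near=> h; congr (u _); near: h; exact: fPc|rewrite /= uqE qfP].
have qd1 g h : q (d1 fP g h) = 0.
  rewrite -d1_ghom (_ : q \o fP = rep1 phi); last by apply/funext => k; exact: qfP.
  by have /asboolP[_ ->] := rep1_Z1 phi.
have inVd1 : (fun g h => ext_inV (d1 (u \o fP) g h)) =
    (fun g h => ext_inV (d1 (ctp_f ca) g h)) + (fun g h => ext_inV (d1 (ctp_f cb) g h)).
  apply/funext => g; apply/funext => h.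
  by rewrite d1_ghom inVD // -!d1_ghom ufa ufb.
have [epsac epsad] := ctp_epsP ca; have [epsbc epsbd] := ctp_epsP cb.
have epsP : cont2 (ctp_eps ca + ctp_eps cb) /\
    d2 (ctp_eps ca + ctp_eps cb) =
      cup21 (@ev _ _ _ _ _ M1) (fun g h => ext_inV (d1 (u \o fP) g h)) (rep1 psi).
  split; first exact: cont2D.
  rewrite d2D epsad epsbd psia psib -(cup21Dl (@evBl _ _ _ _ _ M1)).
  by rewrite inVd1.
have [lE wE] := locP _ _ uqE.
pose c := CTPChoice (conj (rep1_Z1 phi) (rep1K phi)) (conj (rep1_Z1 psi) (rep1K psi))
  fc epsP lE wE.
rewrite (CTP_ctp_sum c) // (CTP_ctp_sum ca) // (CTP_ctp_sum cb) //.
have [_ fina _] := hCTPa _ _ phiS psiS; have [_ finb _] := hCTPb _ _ phiS psiS.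
rewrite /ctp_sum -fsumrD //; apply: eq_fsbigr => v _.
rewrite !ctp_termE -raddfD -cls2D ?ctp_cochain_Z2 //; congr (inv v (cls2 _)).
apply/funext => s; apply/funext => t; rewrite /ctp_cochain /cup11 !fctE /=.
rewrite psia psib addrACA -opprD.
rewrite -(zmod_morphD (@ev_atBl _ _ _ _ _ _ _ _)) -(zmod_morphD (Gm_map_sub _)) la lb.
congr (ev_at _ _ - _).
(* [fP] and the local lift both project to phi at [v], so their difference lies in the kernel of
   [q], where [inVD] applies. *)
rewrite -raddfB inVD; last first.
  by have [_ _ lq] := lP v; rewrite raddfB qfP lq subrr.
by rewrite !raddfB; have [-> ->] := fPE (loc_res (L v) s).
Unshelve. all: by end_near. Qed.
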